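(* For every type $\mathbf m\neq[\,]$, $$C_{\mathbf m}=\sum_{\mathbf k\in L(\mathbf m)}G_{\mathbf k},$$ where $L(\mathbf m)=\{\mathbf k:\ \mathbf m=\mathbf k+\vec j\text{ for some natural }j\ge2\}$ (i.e. the types obtained from $\mathbf m$ by subtracting $1$ from one of its nonzero components).
   Context: A type is a vector $\mathbf m=[m_2,m_3,\ldots]$ of natural numbers (indices start at $2$) with finitely many nonzero entries; $[\,]$ is the zero type, $\vec j$ is the type with $1$ in position $j$ and $0$ elsewhere, and $\mathbf t^{\mathbf m}=t_2^{m_2}t_3^{m_3}\cdots$. The hyper-Catalan number is $C_{\mathbf m}=\frac{(2m_2+3m_3+4m_4+\cdots)!}{(1+m_2+2m_3+3m_4+\cdots)!\,m_2!\,m_3!\cdots}$ and $\mathbf S=\sum_{\mathbf m}C_{\mathbf m}\mathbf t^{\mathbf m}$. It is known that there is a unique formal power series $\mathbf G$ (the Geode) in $t_2,t_3,\ldots$ with $\mathbf S-1=(t_2+t_3+t_4+\cdots)\mathbf G$; $G_{\mathbf n}$ denotes the coefficient of $\mathbf t^{\mathbf n}$ in $\mathbf G$. *)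

(* Defs.v *)
From HB Require Import structures.
From mathcomp Require Import all_boot all_order all_algebra.
From mathcomp Require Import finmap.
From mathcomp Require Import mathcomp_extra boolp classical_sets cardinality.
From mathcomp Require Import fsbigop.

Set Implicit Arguments.
Unset Strict Implicit.
Unset Printing Implicit Defensive.

Import GRing.Theory Num.Theory.

Local Open Scope fset_scope.
Local Open Scope classical_set_scope.
Local Open Scope ring_scope.

Notation index2 := {j : nat | (2 <= j)%N}.

Notation htype := {fsfun index2 -> nat with 0%N}.

Definition type0 : htype := [fsfun].

Definition type1 (j : index2) : htype := [fsfun [fsfun] with j |-> 1%N].

Definition addt (a b : htype) : htype :=
  [fsfun j in (finsupp a `|` finsupp b)%fset => (a j + b j)%N].

Definition hyperCatalan (m : htype) : rat :=
  ((\sum_(j <- finsupp m) val j * m j)%N`!)%:R /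
  (((1 + \sum_(j <- finsupp m) (val j).-1 * m j)%N`!)%:R *
   \prod_(j <- finsupp m) ((m j)`!)%:R).

(* A formal power series in t_2, t_3, ... is identified with its coefficient
   function.  The library's pointwise ring structure on functions is not the
   one meant here: the unit and the product are [fps1] and [fps_mul]. *)
Definition fps := htype -> rat.

Definition fps1 : fps := fun m => (m == type0)%:R.

Definition fps_var (j : index2) : fps := fun m => (m == type1 j)%:R.

Definition fps_sub (A B : fps) : fps := fun m => A m - B m.

(* [\sum_(i \in D) F i] is 0 by convention when F has infinite support in D;
   by [finite_type1], [finite_splittings] and [finite_lower] below, this never
   happens for the sums used here. *)
Definition fps_sumvars : fps := fun m => \sum_(j \in [set: index2]) fps_var j m.

Definition splittings (m : htype) : set (htype * htype) :=
  [set p | addt p.1 p.2 = m].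

Definition fps_mul (A B : fps) : fps :=
  fun m => \sum_(p \in splittings m) A p.1 * B p.2.

Definition hyperCatalan_series : fps := hyperCatalan.

Definition is_geode (G : fps) : Prop :=
  fps_sub hyperCatalan_series fps1 =1 fps_mul fps_sumvars G.

Definition lower (m : htype) : set htype :=
  [set k | exists j : index2, m = addt k (type1 j)].

Lemma addtE (a b : htype) j : addt a b j = (a j + b j)%N.
Proof.
rewrite fsfun_fun in_fsetU; case: (finsuppP a j) => //= _.
by case: (finsuppP b j).
Qed.

Lemma type1E (i j : index2) : type1 i j = (j == i).
Proof. by rewrite /type1 fsfun_withE fsfun0E; case: eqP. Qed.

Lemma finite_type1 (m : htype) : finite_set [set j | m = type1 j].
Proof.
apply: (sub_finite_set _ (finite_fset (finsupp m))) => j /= ->.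
by rewrite mem_finsupp type1E eqxx.
Qed.

Lemma finite_below (m : htype) :
  finite_set [set a : htype | forall j, (a j <= m j)%N].
Proof.
pose N := (\max_(j : finsupp m) m (val j))%N.
pose F (g : {ffun finsupp m -> 'I_N.+1}) : htype :=
  [fsfun j : finsupp m => nat_of_ord (g j)].
apply: (@sub_finite_set _ _ (F @` setT)); last first.
  by apply: finite_image; exact: finite_finset.
move=> a /= le_am; exists [ffun j => inord (a (val j))] => //.
apply/fsfunP => j; rewrite fsfun_ffun; case: insubP => [u _ <-|] /=.
  rewrite ffunE inordK // ltnS (leq_trans (le_am _)) //.
  exact: (leq_bigmax (F := fun j : finsupp m => m (val j)) u).
move/fsfun_dflt => mj0; have := le_am j.
by rewrite mj0 leqn0 => /eqP ->.
Qed.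

Lemma finite_splittings (m : htype) : finite_set (splittings m).
Proof.
apply: (sub_finite_set _ (finite_setX (finite_below m) (finite_below m))).
by move=> [a b] /= <-; split=> j; rewrite addtE ?leq_addr ?leq_addl.
Qed.

Lemma finite_lower (m : htype) : finite_set (lower m).
Proof.
apply: (sub_finite_set _ (finite_below m)).
by move=> k [j ->] i; rewrite addtE leq_addr.
Qed.

(* Main.v *)
Require Import Defs.
From mathcomp Require Import all_boot all_order all_algebra.
From mathcomp Require Import finmap.
From mathcomp Require Import mathcomp_extra boolp classical_sets cardinality.
From mathcomp Require Import fsbigop.
Local Open Scope ring_scope.
Local Open Scope classical_set_scope.

Import GRing.Theory.

(** Away from the zero type the series [fps1] vanishes, so the Geode equation equates $C_{\mathbf
    m}$ with the coefficient of $\mathbf t^{\mathbf m}$ in $(t_2+t_3+\cdots)\mathbf G$. The factor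
    $t_2+t_3+\cdots$ has coefficient 1 at each $\vec j$ and 0 elsewhere, so the convolution keeps
    only the splittings $\mathbf m=\vec j+\mathbf k$, each contributing $G_{\mathbf k}$
    ([fps_mul_sumvarsE]). *)

Lemma addtC (a b : htype) : addt a b = addt b a.
Proof. by apply/fsfunP => j; rewrite !addtE addnC. Qed.

Lemma addt_injr (a b c : htype) : addt a c = addt b c -> a = b.
Proof.
by move=> eq_ab; apply/fsfunP => j; move/fsfunP/(_ j): eq_ab;
  rewrite !addtE => /addIn.
Qed.

Lemma type1_inj : injective type1.
Proof.
move=> i j /fsfunP/(_ i); rewrite !type1E eqxx; by case: eqP.
Qed.

(** Distinct indices give distinct unit types, so exactly one variable contributes. *)
Lemma fps_sumvars_type1 (j : index2) : fps_sumvars (type1 j) = 1.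
Proof.
rewrite /fps_sumvars -(fsbig_widen [set j]) //.
  by rewrite fsbig_set1 /fps_var eqxx.
move=> i [_ /= ij]; rewrite /fps_var.
by case: eqP => // /type1_inj ji; case: ij.
Qed.

Lemma fps_sumvars_eq0 (m : htype) :
  (forall j, m <> type1 j) -> fps_sumvars m = 0.
Proof. by move=> mN1; apply: fsbig1 => j _; rewrite /fps_var; case: eqP => // /mN1. Qed.

Lemma fps_mul_sumvarsE (G : fps) (m : htype) :
  fps_mul fps_sumvars G m = \sum_(k \in lower m) G k.
Proof.
pose D := splittings m `&` [set p | exists j, p.1 = type1 j].
rewrite /fps_mul -(fsbig_widen D); first last.
- move=> p [mp /= pN1] /=; rewrite fps_sumvars_eq0 ?mul0r// => j pj.
  by apply: pN1; split=> //; exists j.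
- by move=> p [].
(* [snd] maps [D] bijectively onto [lower m]: with the total [m] fixed, the second part determines
   the first by cancellation, so no $G_{\mathbf k}$ is counted twice. *)
rewrite (@reindex_fsbig _ _ _ _ _ snd D) //.
  by apply: eq_fsbigr => p; rewrite inE => -[_ [j ->]];
    rewrite fps_sumvars_type1 mul1r.
split.
- by move=> [a b] [<- [j aj]]; exists j; rewrite -aj addtC.
- move=> [a b] [c d]; rewrite !inE => -[ab _] [cd _] /= bd.
  by move: ab; rewrite -cd /splittings /= bd => /addt_injr ->.
- move=> k [j mj]; exists (type1 j, k) => //.
  by split; [rewrite mj; exact: addtC | exists j].
Qed.

Theorem theorem6 (G : fps) (hG : is_geode G) (m : htype) (hm : m <> type0) :
  hyperCatalan m = \sum_(k \in lower m) G k.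
Proof.
rewrite -fps_mul_sumvarsE -hG /fps_sub /fps1.
(* [hm] excludes the only type at which subtracting 1 changes a coefficient. *)
by case: eqP => // _; rewrite subr0.
Qed.
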